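(* Let $n\geq1$ and $S,T\subseteq[n-1]$, and let $$A(q)_{ST}=\sum_{\substack{w\in\mathfrak{S}_n\\ \overline{S}\subseteq C(w),\ T\subseteq D(w)}} q^{\mathrm{inv}(w)}.$$ Then $A(q)_{ST}=q^{z(T)}\,\eta(\overline{S},q)/\eta(\overline{T},q)$ if $\overline{S}\cap T=\emptyset$, and $A(q)_{ST}=0$ otherwise.
   Context: $[n]=\{1,\dots,n\}$, $\mathfrak{S}_n$ is the set of permutations $w=a_1\cdots a_n$ of $[n]$; $\mathrm{inv}(w)=\#\{(i,j): i<j,\ a_i>a_j\}$. For $X\subseteq[n-1]$, $\overline{X}=[n-1]\setminus X$. $D(w)=\{i : a_i>a_{i+1}\}$ and $C(w)=\{i\in[n-1] : a_j<a_k \text{ for all } j\leq i<k\}$. Let $(j)=1+q+\cdots+q^{j-1}$ and $(j)!=(1)(2)\cdots(j)$. For $X=\{i_1<\cdots<i_k\}\subseteq[n-1]$, $\eta(X,q)=(i_1)!\,(i_2-i_1)!\cdots(i_k-i_{k-1})!\,(n-i_k)!$ (the $q$-factorials). For $T\subseteq[n-1]$ with $\overline{T}=\{i_1<\cdots<i_k\}$, $z(T)=\binom{i_1}{2}+\binom{i_2-i_1}{2}+\cdots+\binom{n-i_k}{2}$. *)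

(* Defs.v *)
From HB Require Import structures.
From mathcomp Require Import all_boot all_order all_fingroup all_algebra.
Import GRing.Theory.

Set Implicit Arguments.
Unset Strict Implicit.
Unset Printing Implicit Defensive.

Local Open Scope ring_scope.

(* Indices are 0-based: i : 'I_n.-1 stands for the element i.+1 of            *)
(* [n-1] = {1, ..., n-1}, and w i is the letter a_(i.+1), minus 1, of         *)
(* w = a_1 ... a_n.                                                           *)

Lemma next_pos_subproof n (i : 'I_n.-1) : (i.+1 < n)%N.
Proof. by rewrite -ltn_predRL. Qed.

Definition this_pos n (i : 'I_n.-1) : 'I_n := widen_ord (leq_pred n) i.
Definition next_pos n (i : 'I_n.-1) : 'I_n := Ordinal (next_pos_subproof i).

Definition inv n (w : 'S_n) : nat :=
  #|[set ij : 'I_n * 'I_n | (ij.1 < ij.2)%N && (w ij.2 < w ij.1)%N]|.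

Definition descents n (w : 'S_n) : {set 'I_n.-1} :=
  [set i | (w (next_pos i) < w (this_pos i))%N].

(* The set C(w); the 0-based condition j <= i < k on positions is the         *)
(* 1-based condition j.+1 <= i.+1 < k.+1.                                     *)
Definition connectivity n (w : 'S_n) : {set 'I_n.-1} :=
  [set i : 'I_n.-1 |
    [forall j : 'I_n, forall k : 'I_n, (j <= i < k)%N ==> (w j < w k)%N]].

(* For X = {i_1 < ... < i_k}, the sequence i_1, i_2 - i_1, ..., n - i_k (just *)
(* n if X is empty); enum lists ordinals in increasing order.                 *)
Definition blocks n (X : {set 'I_n.-1}) : seq nat :=
  pairmap (fun a b => (b - a)%N) 0%N
    (rcons [seq (nat_of_ord i).+1 | i <- enum X] n).

Definition qint (j : nat) : {poly int} := \sum_(i < j) 'X^i.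
Definition qfact (j : nat) : {poly int} := \prod_(1 <= i < j.+1) qint i.

Definition eta n (X : {set 'I_n.-1}) : {poly int} :=
  \prod_(b <- blocks X) qfact b.

Definition z n (T : {set 'I_n.-1}) : nat :=
  (\sum_(b <- blocks (~: T)) 'C(b, 2))%N.

Definition A n (S T : {set 'I_n.-1}) : {poly int} :=
  \sum_(w : 'S_n | (~: S \subset connectivity w) && (T \subset descents w))
     'X^(inv w).

(* Main.v *)
(* Delete the first letter c of w and standardize the rest to w' (one step of *)
(* the Lehmer code): inv w = c + inv w', position 1 is a descent iff the first*)
(* letter of w' is less than c, and connectivity of w is that of w' together  *)
(* with c < m, where m is the size of the first block of ~: S.  Since T is    *)
(* disjoint from ~: S, within a first block of ~: T of size b the codes are   *)
(* the strictly decreasing chains below m, so summing them is a q-hockey-stick*)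
(* identity, and each such block contributes q^C(b,2) times a q-binomial; the *)
(* q-binomials telescope to eta (~: S) / eta (~: T).                          *)

Require Import Defs.
From mathcomp Require Import all_boot all_order all_fingroup all_algebra.
From mathcomp Require Import zify ring.
Import GRing.Theory.

Set Implicit Arguments.
Unset Strict Implicit.
Unset Printing Implicit Defensive.

Local Open Scope ring_scope.

(** Put X = [~: S], contained in [~: T], and let m and k+1 be the first block sizes of X and [~: T].
    The invariant ([restricted_inv_gfE]) is that the permutations with first letter c < m contribute
    q^c q^C(k,2) times the q-binomial of c over k, times a factor R independent of c. Stripping the
    first letter ([restricted_inv_gf_ordS]) gives the induction. A descent there lengthens the
    block: summing over d < c by [sum_qffact] raises k by one. A non-descent position of T closes
    the block: summing over all c < m gives q^C(k+1,2) (m)!/((k+1)!(m-k-1)!) ([qfact_mul_total]).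
    Here m-k-1 is what is left of the first block of X, so (m-k-1)! cancels against the next block
    of [~: T], and the product telescopes. *)

(** * Index sets and their blocks when the first position is removed *)

Definition unlift_set {n} (X : {set 'I_n.+1}) : {set 'I_n} :=
  [set i | lift ord0 i \in X].

Lemma unlift_setC n (X : {set 'I_n.+1}) : unlift_set (~: X) = ~: unlift_set X.
Proof. by apply/setP => i; rewrite !inE. Qed.

Lemma subset_ordS n (X Y : {set 'I_n.+1}) :
  (X \subset Y) =
  ((ord0 \in X) ==> (ord0 \in Y)) && (unlift_set X \subset unlift_set Y).
Proof.
apply/subsetP/andP => [XY | [/implyP XY0 /subsetP XY] i].
  split; first by apply/implyP => /XY.
  by apply/subsetP => i; rewrite !inE => /XY.
by case: (unliftP ord0 i) => [j ->|->] //; move: (XY j); rewrite !inE.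
Qed.

(** The boolean [ord0 \in X] is coerced to a length, so the first list is [[:: ord0]] or empty. *)
Lemma enum_ordS n (X : {set 'I_n.+1}) :
  enum X = [seq ord0 | _ <- iota 0 (ord0 \in X)] ++
           [seq lift ord0 i | i <- enum (unlift_set X)].
Proof.
rewrite {1}/enum_mem -enumT enum_ordSl /= filter_map /=.
have -> : filter (preim (lift ord0) (mem X)) (enum 'I_n) = enum (unlift_set X).
  rewrite [in RHS]/enum_mem -enumT; apply: eq_filter => i.
  by rewrite /= inE.
by case: (ord0 \in X).
Qed.

Lemma pairmap_subSS a s :
  pairmap (fun a b => b - a)%N a.+1 [seq i.+1 | i <- s] =
  pairmap (fun a b => b - a)%N a s.
Proof. by elim: s a => //= x s IH a; rewrite IH subSS. Qed.

(** A new first position shifts all later cuts by one, which leaves their differences unchanged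
    beyond the first. *)
Lemma blocks_ordS n (X : {set 'I_n.+1}) :
  @blocks n.+2 X =
  if ord0 \in X then 1%N :: @blocks n.+1 (unlift_set X)
  else (head 0%N (@blocks n.+1 (unlift_set X))).+1
         :: behead (@blocks n.+1 (unlift_set X)).
Proof.
rewrite /blocks enum_ordS /=.
set l := rcons [seq (nat_of_ord i).+1 | i <- enum (unlift_set X)] n.+1.
have El : rcons [seq (nat_of_ord i).+1 |
              i <- [seq lift ord0 i | i <- enum (unlift_set X)]] n.+2 =
          [seq i.+1 | i <- l].
  by rewrite map_rcons -!map_comp; congr rcons; apply: eq_map => i /=.
have : l != [::] by rewrite /l; case: (map _ _).
case: ifP => _ /=; rewrite El.
  by rewrite pairmap_subSS subn0.
by case: l {El} => //= x s _; rewrite pairmap_subSS !subn0.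
Qed.

Lemma blocks_ord0 (X : {set 'I_0}) : @blocks 1 X = [:: 1%N].
Proof.
suff E : enum X = [::] by rewrite /blocks E.
by case: (enum X) => // -[].
Qed.

Lemma blocks_cons n (X : {set 'I_n}) :
  @blocks n.+1 X =
  (head 0%N (@blocks n.+1 X)) :: behead (@blocks n.+1 X).
Proof.
case: n X => [|n] X; first by rewrite blocks_ord0.
by rewrite blocks_ordS; case: ifP.
Qed.

(** The first block size is the least cut, or [n.+1] without cuts; bounding it from below by [c]
    avoids naming that minimum. *)
Lemma ltn_head_blocks n (X : {set 'I_n}) c :
  (c < head 0%N (@blocks n.+1 X))%N =
  (c < n.+1)%N && [forall i in X, (c <= i)%N].
Proof.
elim: n X c => [|n IH] X c.
  rewrite blocks_ord0 /=; case: ltnP => // _.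
  by apply/esym/forall_inP => -[].
rewrite blocks_ordS.
have -> : [forall i in X, (c <= i)%N] =
    ((ord0 \in X) ==> (c <= 0)%N) &&
    [forall i in unlift_set X, (c <= i.+1)%N].
  apply/forall_inP/andP => [H | [/implyP H0 /forall_inP H] i].
    split; first by apply/implyP => /H.
    by apply/forall_inP => i; rewrite inE => /H.
  by case: (unliftP ord0 i) => [j ->|->] // iX; apply: (H j); rewrite inE.
case: ifP => _ /=.
  case: c => [|c] /=; last by rewrite andbF.
  by apply/esym/forall_inP.
by case: c => [|c] /=; [apply/esym/forall_inP | rewrite ltnS IH].
Qed.

(** * Inversions, descents and connectivity when the first letter is removed *)

Lemma sum_ltn_ord n m : (m <= n)%N -> (\sum_(i < n) (i < m))%N = m.
Proof.
move=> mn; rewrite -[RHS]card_ord -sum1_card (eq_bigl xpredT) //.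
by rewrite (big_ord_widen_cond n xpredT (fun=> 1%N)) // [RHS]big_mkcond.
Qed.

(** By counting, the prefix lies below the suffix exactly when [w] maps the initial segment into
    itself. This one-sided form is easy to follow through [lift_perm]. *)
Lemma connectivityE n (w : 'S_n.+1) (i : 'I_n) :
  (i \in @connectivity n.+1 w) =
  [forall j : 'I_n.+1, (j <= i)%N ==> (w j <= i)%N].
Proof.
have card_le (k : nat) : (k < n.+1)%N -> #|[set j : 'I_n.+1 | (j <= k)%N]| = k.+1.
  by move=> kn; rewrite -sum1dep_card big_mkcond; apply: (sum_ltn_ord kn).
have iltn : (i < n.+1)%N by rewrite ltnS ltnW.
rewrite inE; apply/'forall_forallP/'forall_implyP => H.
  move=> j ji; rewrite leqNgt; apply/negP => ij.
  (* If [w j > i], the [n - i] letters to the right of position [i] all exceed [w j], but only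
     [n - w j] values do. *)
  have sub : [set w k | k in [set k : 'I_n.+1 | ~~ (k <= i)%N]] \subset
      [set k : 'I_n.+1 | ~~ (k <= w j)%N].
    apply/subsetP => _ /imsetP[k + ->]; rewrite !inE -!ltnNge => ik.
    by have /implyP := H j k; rewrite ji; apply.
  have := subset_leq_card sub; rewrite card_imset; last exact: perm_inj.
  have cC k : (k < n.+1)%N ->
      #|[set j : 'I_n.+1 | ~~ (j <= k)%N]| = (n - k)%N.
    move=> kn; have := cardsC [set j : 'I_n.+1 | (j <= k)%N].
    rewrite card_le // card_ord.
    have -> : ~: [set j : 'I_n.+1 | (j <= k)%N] = [set j : 'I_n.+1 | ~~ (j <= k)%N].
      by apply/setP => x; rewrite !inE.
    lia.
  by rewrite !cC //; have := ltn_ord (w j); lia.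
move=> j k; apply/implyP => /andP[ji ik].
pose B := [set j : 'I_n.+1 | (j <= i)%N].
have wB : w @: B = B.
  apply/eqP; rewrite eqEcard card_imset ?leqnn ?andbT; last exact: perm_inj.
  by apply/subsetP => _ /imsetP[l + ->]; rewrite !inE; apply: H.
apply: leq_ltn_trans (H j ji) _; rewrite ltnNge; apply/negP => wki.
have : w k \in w @: B by rewrite wB inE.
by rewrite mem_imset ?inE 1?leqNgt ?ik //; apply: perm_inj.
Qed.

Lemma ltn_lift n (c : 'I_n.+1) (x y : 'I_n) : (lift c x < lift c y)%N = (x < y)%N.
Proof. by rewrite /= /bump; lia. Qed.

Lemma inv_sum n (w : 'S_n) :
  Defs.inv w = (\sum_(i < n) \sum_(j < n) ((i < j) && (w j < w i)))%N.
Proof.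
by rewrite /Defs.inv -sum1dep_card big_mkcond pair_bigA.
Qed.

(** The first letter [c] exceeds exactly [c] later letters, and [lift c] preserves the order of the
    others. *)
Lemma inv_lift_perm n (c : 'I_n.+1) (w : 'S_n) :
  Defs.inv (lift_perm ord0 c w) = (c + Defs.inv w)%N.
Proof.
rewrite !inv_sum big_ord_recl big_ord_recl /= add0n.
congr addn.
  rewrite (eq_bigr (fun j : 'I_n => nat_of_bool (w j < c)%N)); last first.
    by move=> j _; rewrite lift_perm_id lift_perm_lift /= /bump; congr nat_of_bool; lia.
  have cn : (c <= n)%N := leq_ord c.
  by rewrite -[RHS](sum_ltn_ord cn) [RHS](reindex_inj (@perm_inj _ w)).
apply: eq_bigr => i _; rewrite big_ord_recl /= add0n.
by apply: eq_bigr => j _; rewrite !lift_perm_lift ltn_lift /bump.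
Qed.

Lemma ord0_descents n (c : 'I_n.+2) (w : 'S_n.+1) :
  (ord0 \in @descents n.+2 (lift_perm ord0 c w)) = (w ord0 < c)%N.
Proof.
rewrite inE.
have -> : @this_pos n.+2 ord0 = ord0 by apply: val_inj.
have -> : @next_pos n.+2 ord0 = lift ord0 ord0 by apply: val_inj.
by rewrite lift_perm_id lift_perm_lift /= /bump; lia.
Qed.

Lemma unlift_descents n (c : 'I_n.+2) (w : 'S_n.+1) :
  unlift_set (@descents n.+2 (lift_perm ord0 c w)) = @descents n.+1 w.
Proof.
apply/setP => i; rewrite !inE.
have -> : @this_pos n.+2 (lift ord0 i) = lift ord0 (@this_pos n.+1 i)
  by apply: val_inj.
have -> : @next_pos n.+2 (lift ord0 i) = lift ord0 (@next_pos n.+1 i)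
  by apply: val_inj.
by rewrite !lift_perm_lift ltn_lift.
Qed.

Lemma ord0_connectivity n (c : 'I_n.+2) (w : 'S_n.+1) :
  (ord0 \in @connectivity n.+2 (lift_perm ord0 c w)) = (c <= 0)%N.
Proof.
rewrite connectivityE; apply/'forall_implyP/idP => [/(_ ord0)|c0 j j0].
  by rewrite lift_perm_id; apply.
have -> : j = ord0 by apply: val_inj; move: j0; rewrite leqn0 => /eqP.
by rewrite lift_perm_id.
Qed.

Lemma leq_bumpS c v i : (c <= i.+1)%N -> (bump c v <= i.+1)%N = (v <= i)%N.
Proof. by rewrite /bump; lia. Qed.

Lemma lift_connectivity n (c : 'I_n.+2) (w : 'S_n.+1) i :
  (lift ord0 i \in @connectivity n.+2 (lift_perm ord0 c w)) =
  (c <= i.+1)%N && (i \in @connectivity n.+1 w).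
Proof.
rewrite !connectivityE.
apply/'forall_implyP/andP => [H|[ci /'forall_implyP H] j].
  have ci : (c <= i.+1)%N by have := H ord0; rewrite lift_perm_id; apply.
  split=> //; apply/'forall_implyP => j ji.
  by have := H (lift ord0 j); rewrite lift_perm_lift /= (leq_bumpS _ ci); apply.
case: (unliftP ord0 j) => [k ->|->]; rewrite ?lift_perm_id //.
by rewrite lift_perm_lift /= (leq_bumpS _ ci); apply: H.
Qed.

(** Each cut [i] in [X] forces [c <= i]; together these bounds say that [c] is less than the first
    block size. *)
Lemma subset_connectivity n (X : {set 'I_n.+1}) (c : 'I_n.+2) (w : 'S_n.+1) :
  (X \subset @connectivity n.+2 (lift_perm ord0 c w)) =
  (c < head 0%N (@blocks n.+2 X))%N && (unlift_set X \subset @connectivity n.+1 w).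
Proof.
rewrite ltn_head_blocks ltn_ord /=.
apply/subsetP/andP => [H|[/forall_inP H /subsetP Hw] i].
  split.
    apply/forall_inP => i /H; case: (unliftP ord0 i) => [j ->|->].
      by rewrite lift_connectivity => /andP[].
    by rewrite ord0_connectivity.
  by apply/subsetP => i; rewrite inE => /H; rewrite lift_connectivity => /andP[].
case: (unliftP ord0 i) => [j ->|->] iX; have := H _ iX.
  by rewrite lift_connectivity => ->; apply: Hw; rewrite inE.
by rewrite ord0_connectivity.
Qed.

(** * The recursion on the first letter *)

Lemma sum_lift_perm (V : nmodType) n (F : 'S_n.+1 -> V) :
  \sum_(w : 'S_n.+1) F w =
  \sum_(c < n.+1) \sum_(w : 'S_n) F (lift_perm ord0 c w).
Proof.
rewrite pair_bigA /=.
have inj : injective (fun p : 'I_n.+1 * 'S_n => lift_perm ord0 p.1 p.2).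
  move=> [c w] [d u] /= E.
  have cd : c = d by have /(congr1 (fun s : 'S_n.+1 => s ord0)) := E; rewrite !lift_perm_id.
  subst d; congr pair; apply/permP => i.
  have /(congr1 (fun s : 'S_n.+1 => s (lift ord0 i))) := E.
  by rewrite !lift_perm_lift => /lift_inj.
rewrite (reindex _ (onW_bij _ (inj_card_bij inj _))) //=.
by rewrite card_prod !card_Sn card_ord factS.
Qed.

(* The constraint P on the first letter makes the recursion on n close up. *)
Definition restricted_inv_gf n (X T : {set 'I_n}) (P : pred nat) : {poly int} :=
  \sum_(w : 'S_n.+1 | [&& X \subset @connectivity n.+1 w,
                          T \subset @descents n.+1 w & P (w ord0)]) 'X^(Defs.inv w).

(** A descent required at the first position turns into the constraint [d < c] on the next letter,
    so the sum stays in the same family. *)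
Lemma restricted_inv_gf_ordS n (X T : {set 'I_n.+1}) (P : pred nat) :
  restricted_inv_gf X T P =
  \sum_(0 <= c < head 0%N (@blocks n.+2 X) | P c)
     'X^c * restricted_inv_gf (unlift_set X) (unlift_set T)
              (fun d => (ord0 \in T) ==> (d < c)%N).
Proof.
have mn : (head 0%N (@blocks n.+2 X) <= n.+2)%N.
  case E : (head _ _) => [|m] //.
  by have := ltn_head_blocks X m; rewrite E ltnSn => /esym/andP[].
rewrite (big_nat_widen _ _ _ _ _ mn) big_mkord.
rewrite /restricted_inv_gf big_mkcond sum_lift_perm [RHS]big_mkcond /=.
apply: eq_bigr => c _; rewrite -big_mkcond /=.
under eq_bigl => w.
  rewrite subset_connectivity subset_ordS ord0_descents unlift_descents lift_perm_id.
  over.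
under eq_bigr => w _ do rewrite inv_lift_perm exprD.
case: ifP => [/andP[Pc cm]|Pc].
  rewrite big_distrr /=; apply: eq_bigl => w.
  by rewrite Pc cm andbT /=; do !bool_congr.
apply: big_pred0 => w; move: Pc.
by case: (P c); rewrite ?andbF //= => ->.
Qed.

(** * Falling q-factorials *)

(** This is (k)! times the q-binomial of c over k, which avoids division. For [c < k] the factor
    [qint 0 = 0] occurs, so truncated subtraction does no harm. *)
Definition qffact (c k : nat) : {poly int} := \prod_(i < k) qint (c - i).

Lemma qintS j : qint j.+1 = qint j + 'X^j.
Proof. by rewrite /qint big_ord_recr. Qed.

Lemma qintD j k : qint (j + k) = qint j + 'X^j * qint k.
Proof.
elim: k => [|k IH]; first by rewrite addn0 /qint big_ord0 mulr0 addr0.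
by rewrite addnS !qintS IH exprD mulrDr addrA.
Qed.

Lemma qfactS j : qfact j.+1 = qfact j * qint j.+1.
Proof. by rewrite /qfact big_nat_recr. Qed.

Lemma qfact0 : qfact 0 = 1.
Proof. by rewrite /qfact big_geq. Qed.

Lemma qffactSr c k : qffact c k.+1 = qffact c k * qint (c - k).
Proof. by rewrite /qffact big_ord_recr. Qed.

Lemma qffactSS c k : qffact c.+1 k.+1 = qint c.+1 * qffact c k.
Proof. by rewrite /qffact big_ord_recl. Qed.

Lemma qffact_small c k : (c < k)%N -> qffact c k = 0.
Proof.
move=> ck; rewrite /qffact (bigD1 (Ordinal ck)) //= subnn.
by rewrite {1}/qint big_ord0 mul0r.
Qed.

Lemma qffact_fact c k : (k <= c)%N -> qffact c k * qfact (c - k) = qfact c.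
Proof.
elim: k => [|k IH] kc; first by rewrite /qffact big_ord0 mul1r subn0.
rewrite -[in RHS]IH 1?ltnW // qffactSr -mulrA; congr (_ * _).
by have -> : (c - k = (c - k.+1).+1)%N; [lia | rewrite qfactS mulrC].
Qed.

(* The q-hockey-stick identity, multiplied by (k+1)!. *)
Lemma sum_qffact c k :
  (\sum_(0 <= d < c) 'X^d * qffact d k) * qint k.+1 = 'X^k * qffact c k.+1.
Proof.
elim: c => [|c IH].
  by rewrite big_geq // mul0r qffact_small // mulr0.
rewrite big_nat_recr //= mulrDl IH qffactSS qffactSr.
case: (ltnP c k) => [ck|kc].
  by rewrite qffact_small // !(mulr0, mul0r) addr0.
(* This splitting of (c+1) is the q-Pascal rule. *)
have -> : qint c.+1 = qint (c - k) + 'X^(c - k) * qint k.+1.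
  by rewrite -qintD addnS subnK.
have -> : 'X^c = 'X^k * 'X^(c - k) :> {poly int} by rewrite -exprD subnKC.
by ring.
Qed.

(** * The product formula, block by block *)

Lemma head_blocks_gt0 n (X : {set 'I_n}) : (0 < head 0%N (@blocks n.+1 X))%N.
Proof. by rewrite ltn_head_blocks; apply/andP; split=> //; apply/forall_inP. Qed.

Lemma head_blocks_sub n (X Y : {set 'I_n}) : X \subset Y ->
  (head 0%N (@blocks n.+1 Y) <= head 0%N (@blocks n.+1 X))%N.
Proof.
move=> /subsetP XY; case E : (head 0%N (@blocks n.+1 Y)) => [|b] //.
have := ltn_head_blocks Y b; rewrite E ltnSn => /esym/andP[bn /forall_inP H].
by rewrite ltn_head_blocks bn; apply/forall_inP => i /XY /H.
Qed.

Lemma eq_restricted_inv_gf n (X T : {set 'I_n}) (P Q : pred nat) :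
  P =1 Q -> restricted_inv_gf X T P = restricted_inv_gf X T Q.
Proof. by move=> PQ; apply: eq_bigl => w; rewrite PQ. Qed.

(** Closes a block of size k+1: with no constraint on the first letter, [sum_qffact] evaluates the
    sum over c < m, and C(k,2) + k = C(k+1,2). [EX] and [ET] stand for the factors of the later
    blocks. *)
Lemma qfact_mul_total (G R EX ET : {poly int}) m k e :
  (k < m)%N ->
  qfact k * G = \sum_(0 <= c < m) 'X^c * qffact c k * ('X^('C(k, 2)) * R) ->
  R * ET = 'X^e * (qfact (m - k.+1) * EX) ->
  G * (qfact k.+1 * ET) = 'X^('C(k.+1, 2) + e) * (qfact m * EX).
Proof.
move=> km HG HR.
transitivity (qfact k * G * qint k.+1 * ET); first by rewrite qfactS; ring.
rewrite HG -mulr_suml [_ * qint k.+1]mulrAC sum_qffact.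
transitivity ('X^('C(k, 2)) * 'X^k * qffact m k.+1 * (R * ET)); first by ring.
by rewrite HR -(qffact_fact km) binS bin1 exprD [('C(k, 2) + k)%N]addnC exprD; ring.
Qed.

(* Here k = b - 1, and the factor R is the contribution of all positions      *)
(* after the first block of ~: T; it stays the same as that block grows.      *)
Lemma restricted_inv_gfE n (X T : {set 'I_n}) : X \subset ~: T ->
  let BX := @blocks n.+1 X in let BT := @blocks n.+1 (~: T) in
  let k := (head 0%N BT).-1 in
  exists R : {poly int},
    (forall P, qfact k * restricted_inv_gf X T P =
       \sum_(0 <= c < head 0%N BX | P c) 'X^c * qffact c k * ('X^('C(k, 2)) * R)) /\
    R * (\prod_(b <- behead BT) qfact b) =
      'X^(\sum_(b <- behead BT) 'C(b, 2)) *
        (qfact (head 0%N BX - k.+1) * \prod_(b <- behead BX) qfact b).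
Proof.
elim: n X T => [|n IH] X T XT BX BT k.
  exists 1; rewrite /k /BX /BT !blocks_ord0 /= !big_nil.
  split=> [P|]; last by rewrite subnn qfact0 expr0 !mulr1.
  have E (w : 'S_1) : w = 1%g by apply/permP => i; rewrite !ord1.
  have e0 (Y Z : {set 'I_0}) : Y \subset Z by apply/subsetP => -[].
  rewrite [RHS]big_mkcond big_nat1 /restricted_inv_gf qfact0 mul1r.
  rewrite (eq_bigl (fun=> P 0%N)) => [|w]; last by rewrite !e0 (E w) perm1.
  case: (P 0%N); last by rewrite big_pred0.
  rewrite (big_pred1 1%g) => [|w]; last by rewrite [w]E; apply/esym/eqP.
  by rewrite inv_sum !big_ord1 /qffact big_ord0 !expr0 !mulr1.
move: (XT); rewrite subset_ordS unlift_setC => /andP[X0T X'T'].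
have [R [HG HR]] := IH _ _ X'T'.
set BX' := @blocks n.+1 (unlift_set X) in HG HR.
set BT' := @blocks n.+1 (~: unlift_set T) in HG HR.
set k' := (head 0%N BT').-1 in HG HR.
have k'S : k'.+1 = head 0%N BT' by rewrite prednK // head_blocks_gt0.
have k'm : (k' < head 0%N BX')%N by rewrite k'S head_blocks_sub.
have EBX' : BX' = head 0%N BX' :: behead BX' by apply: blocks_cons.
have EBT' : BT' = head 0%N BT' :: behead BT' by apply: blocks_cons.
have := blocks_ordS (~: T); rewrite -/BT unlift_setC -/BT' inE.
have := blocks_ordS X; rewrite -/BX -/BX'.
case: (boolP (ord0 \in T)) => T0 EX ET /=.
  have {}EX : BX = (head 0%N BX').+1 :: behead BX'.
    by rewrite EX; move: X0T; rewrite inE T0 implybF => /negbTE ->.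
  have kE : k = k'.+1 by rewrite /k ET /= -k'S.
  (* Position 0 is a cut of neither [X] nor [~: T], so both first blocks grow by one, their
     difference is unchanged, and the same [R] serves. *)
  exists R; rewrite kE EX ET /= subSS; split=> // P.
  rewrite restricted_inv_gf_ordS -/BX EX /= big_distrr /=.
  rewrite big_nat_cond [RHS]big_nat_cond; apply: eq_bigr => c /andP[cm _].
  rewrite T0 /= qfactS.
  transitivity ('X^c * (qfact k' * restricted_inv_gf (unlift_set X) (unlift_set T)
      (fun d => d < c)%N) * qint k'.+1); first by ring.
  rewrite HG -mulr_suml.
  (* Since [c] is at most [head 0%N BX'], the bound [d < c] is the only effective one. *)
  have -> : \sum_(0 <= d < head 0%N BX' | (d < c)%N) 'X^d * qffact d k' =
            \sum_(0 <= d < c) 'X^d * qffact d k'.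
    by rewrite [RHS](big_nat_widen _ _ (head 0%N BX')).
  transitivity ('X^c * ((\sum_(0 <= d < c) 'X^d * qffact d k') * qint k'.+1) *
      'X^('C(k', 2)) * R); first by ring.
  by rewrite sum_qffact binS bin1 [('C(k', 2) + k')%N]addnC exprD; ring.
have {}ET : BT = 1%N :: BT' by [].
have kE : k = 0%N by rewrite /k ET.
(* A block of size 1 begins and passes no constraint on, so the rest contributes its whole
   generating function; [qfact_mul_total] then closes the previous block. *)
exists (restricted_inv_gf (unlift_set X) (unlift_set T) predT).
rewrite kE ET /=; split=> [P|].
  rewrite qfact0 mul1r restricted_inv_gf_ordS; apply: eq_bigr => c _.
  rewrite /qffact big_ord0 mulr1 expr0 mul1r (negbTE T0).
  by congr (_ * _); apply: eq_restricted_inv_gf.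
rewrite EBT' !big_cons -k'S.
rewrite (qfact_mul_total k'm (HG predT) HR).
(* If [X] also cuts here, its first block is used up and leaves (0)! = 1; otherwise removing one
   position leaves the old first block. *)
by rewrite EX; case: ifP => _ /=; rewrite ?subnn ?qfact0 ?mul1r 1?EBX' ?big_cons // subSS subn0.
Qed.

Lemma restricted_inv_gf_eta n (X T : {set 'I_n}) : X \subset ~: T ->
  restricted_inv_gf X T predT * @eta n.+1 (~: T) =
  'X^(@z n.+1 T) * @eta n.+1 X.
Proof.
move=> XT; have [R [HG HR]] := restricted_inv_gfE XT.
have kS := prednK (head_blocks_gt0 (~: T)).
have km := head_blocks_sub XT; rewrite -kS in km.
rewrite /eta /z (blocks_cons X) (blocks_cons (~: T)) !big_cons -kS.
exact: qfact_mul_total (HG predT) HR.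
Qed.

(** * Nonzero denominators and the conclusion *)

(** The value at q = 0 is 1. *)
Lemma qint_neq0 j : (0 < j)%N -> qint j != 0.
Proof.
case: j => // j _; apply/eqP => /(congr1 (fun p => p.[0])).
rewrite /qint big_ord_recl !hornerE horner_sum big1 ?addr0 => [|i _].
  by move/eqP; rewrite oner_eq0.
by rewrite !hornerE expr0n.
Qed.

Lemma eta_neq0 n (X : {set 'I_n.-1}) : eta X != 0.
Proof.
rewrite prodf_seq_neq0; apply/allP => b _ /=.
rewrite /qfact prodf_seq_neq0; apply/allP => i.
by rewrite mem_index_iota => /andP[/qint_neq0].
Qed.

Theorem theorem2p2 (n : nat) (hn : (1 <= n)%N) (S T : {set 'I_n.-1}) :
  ((~: S) :&: T = set0 ->
     tofrac (A S T) = tofrac ('X^(z T)) * tofrac (eta (~: S)) / tofrac (eta (~: T))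
       :> {fraction {poly int}})
  /\ ((~: S) :&: T <> set0 -> A S T = 0).
Proof.
split=> [ST|/eqP/set0Pn[i]].
  case: n hn S T ST => // n _ S T /eqP; rewrite setI_eq0 disjoints_subset => ST.
  have AE : A S T = restricted_inv_gf (~: S) T predT.
    by apply: eq_bigl => w; rewrite andbT.
  apply: (@mulIf _ (tofrac (eta (~: T)))); first by rewrite tofrac_eq0 eta_neq0.
  rewrite mulfVK ?tofrac_eq0 ?eta_neq0 // -!tofracM AE.
  by rewrite -(restricted_inv_gf_eta ST).
(* At a common position [i], connectivity forces an ascent while [T] demands a descent, so no
   permutation qualifies. *)
rewrite inE => /andP[iS iT]; apply: big_pred0 => w; apply/negP.
case/andP => /subsetP/(_ i iS) + /subsetP/(_ i iT).
rewrite !inE => /'forall_forallP/(_ (this_pos i) (next_pos i)).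
by rewrite /= leqnn ltnSn /= => lt1 /(ltn_trans lt1); rewrite ltnn.
Qed.
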